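(* Consider the problem $\min_{x\in\mathcal H}F(x)=f(x)+\psi(x)$ described in the context. Suppose there is $L\ge0$ with $$\|f'(y)-f'(x)-H(x)(y-x)\|_*\le L\|x-y\|\qquad\text{for all }x,y\in\mathcal H,$$ and that the subproblem assumption (see context) holds with this $L$. Let $(x_k)_{k\in\mathbb N}$ be the iterates of the LeAP-SSN algorithm (see context) with arbitrary starting point $x_0\in\operatorname{dom}F$. Let the sublevel set $\mathcal F_0=\{x\in\operatorname{dom}F:F(x)\le F(x_0)\}$ be bounded, put $D_0=\sup_{x,y\in\mathcal F_0}\|x-y\|<\infty$, and let $F$ be convex on $\mathcal F_0$. Then for all $k\ge1$, $$F(x_k)-F^*\le\|F'(x_0)\|_*D_0\exp\Big(-\frac k4\Big)+\frac{2D_0^2\max\{2mL,\Lambda_0\}}{\alpha k}.$$ If in addition $\lambda_k\to0$ as $k\to\infty$, then $F(x_k)-F^*=o(1/k)$. Moreover, the number of Newton steps (computations of the regularised proximal Newton step $x_+$ in the algorithm) up to the end of iteration $k$ does not exceed $k+1+\log_2\max\{1/2,\,mL/\Lambda_0\}$.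
   Context: Setting. $\mathcal H$ is a real Hilbert space with norm $\|\cdot\|$, dual $\mathcal H^*$ with norm $\|\cdot\|_*$, duality pairing $\langle\cdot,\cdot\rangle$, and Riesz map $\mathcal R:\mathcal H\to\mathcal H^*$. $f\in C^{1,1}(\mathcal H;\mathbb R)$ (Fréchet differentiable with Lipschitz derivative $f'$); $\psi:\mathcal H\to\mathbb R\cup\{+\infty\}$ is proper, convex, lower semicontinuous; $F=f+\psi$ is bounded below with minimal value $F^*$ and the solution set $S=\{x:F(x)=F^*\}$ is nonempty. $\operatorname{dom}F=\{F<+\infty\}$; $\partial\psi$ is the convex subdifferential and $\partial F(x)=f'(x)+\partial\psi(x)$. To every $x\in\mathcal H$ is associated a symmetric bounded linear operator $H(x):\mathcal H\to\mathcal H^*$. Subproblem. For $x\in\operatorname{dom}F$ and $\lambda\ge0$ let $\widetilde F(y;x,\lambda)=f(x)+\langle f'(x),y-x\rangle+\frac12\langle H(x)(y-x),y-x\rangle+\frac\lambda2\|y-x\|^2+\psi(y)$. A point $x_+=x_+(\lambda,x)$ is an admissible solution if (FO) $-f'(x)-H(x)(x_+-x)-\lambda\mathcal R(x_+-x)\in\partial\psi(x_+)$ and (D) $\widetilde F(x_+;x,\lambda)\le\widetilde F(x;x,\lambda)=F(x)$. For such a point set $\psi'(x_+)=-f'(x)-H(x)(x_+-x)-\lambda\mathcal R(x_+-x)$ and $F'(x_+)=f'(x_+)+\psi'(x_+)\in\partial F(x_+)$. Subproblem assumption (with constant $L$): for all $\lambda\ge L$ and all $x\in\operatorname{dom}F$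 an admissible solution exists (and can be computed). LeAP-SSN algorithm. Input: $\alpha\in(0,1/2]$, $\beta\in(0,(m-1)/(2m)]$ for some $m\ge1$, $x_0\in\operatorname{dom}F$, $\psi'(x_0)\in\partial\psi(x_0)$, $\Lambda_0>0$; $F'(x_0)=f'(x_0)+\psi'(x_0)$. At iteration $k=0,1,\dots$: for $j=0,1,\dots$, set $\lambda=2^j\Lambda_k$; attempt to compute an admissible solution $x_+=x_+(\lambda,x_k)$ (if not possible, go to the next $j$); if $$\langle F'(x_+),x_k-x_+\rangle\ge\tfrac\alpha\lambda\|F'(x_+)\|_*^2\quad\text{and}\quad F(x_k)-F(x_+)\ge\beta\lambda\|x_+-x_k\|^2,$$ accept: set $j_k=j$, $x_{k+1}=x_+$, $\lambda_k=\lambda=2^{j_k}\Lambda_k$, $\Lambda_{k+1}=\lambda_k/2$, $F'(x_{k+1})=F'(x_+)$ and go to iteration $k+1$; otherwise go to the next $j$.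
   Formalization: The bound on Newton steps is proved for the sum of j_i over iterations 0..k, not counting the accepted trial on top of j_i; counting every computation of x_+ the stated bound is false, and the result gives 2(k+1)+log_2 max{1/2, mL/Lambda_0}. *)

(* Defs.v *)
From HB Require Import structures.
From mathcomp Require Import all_boot all_order all_algebra.
From mathcomp Require Import sesquilinear.
From mathcomp Require Import all_classical all_reals all_analysis.

Set Implicit Arguments.
Unset Strict Implicit.
Unset Printing Implicit Defensive.
Import Order.TTheory GRing.Theory Num.Theory.
Import numFieldNormedType.Exports.
Local Open Scope classical_set_scope.
Local Open Scope ring_scope.

(* A real Hilbert space is a completeNormedModType H over a realType together
   with a form ip : {dot H for idfun} such that ip x x = `|x| ^+ 2.
   Elements of the dual H^* are functions H -> R^o satisfying in_dual; the
   pairing <phi, v> is the application phi v, and sums and multiples of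
   functionals are those of the function space. *)
Section Dual.
Context {R : realType} {H : completeNormedModType R}.
Implicit Types (phi : H -> R^o).

Definition in_dual phi : Prop := linear phi /\ continuous phi.

(* This is the operator norm only for phi satisfying in_dual: sup is 0 on a set
   that is not bounded above. *)
Definition dual_norm phi : R := sup [set `|phi v| | v in [set v | `|v| <= 1]].

Definition riesz (ip : {dot H for idfun}) (u : H) : H -> R^o :=
  fun v => ip u v.

Definition sym_bounded_operator (A : H -> (H -> R^o)) : Prop :=
  [/\ linear A,
      (forall u, in_dual (A u)),
      (exists M : R, forall u, dual_norm (A u) <= M * `|u|) &
      (forall u v, A u v = A v u)].

Definition frechet (f : H -> R^o) (x : H) : H -> R^o := 'd f x.

Definition C11 (f : H -> R^o) : Prop :=
  (forall x, differentiable f x) /\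
  exists M : R, forall x y,
    dual_norm (frechet f x - frechet f y) <= M * `|x - y|.

End Dual.

Section ExtendedConvex.
Context {R : realType} {H : completeNormedModType R}.
Local Open Scope ereal_scope.
Implicit Types (psi : H -> \bar R) (A : set H).

Definition proper_fun psi : Prop :=
  (forall x, psi x != -oo) /\ (exists x, psi x < +oo).

(* If A is a sublevel set of psi, the inequality forces A to be convex. *)
Definition convex_on A psi : Prop :=
  forall x y, A x -> A y -> forall t : R, (0 <= t <= 1)%R ->
    psi (t *: x + (1 - t) *: y)%R <= t%:E * psi x + (1 - t)%:E * psi y.

Definition subdifferential psi (x : H) : set (H -> R^o) :=
  [set phi | [/\ in_dual phi, psi x \is a fin_num &
     forall y, psi x + (phi (y - x)%R)%:E <= psi y]].

Definition diameter A : R := sup [set `|p.1 - p.2|%R | p in A `*` A].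

End ExtendedConvex.

Section LeAPSSN.
Context {R : realType} {H : completeNormedModType R}.
Variables (ip : {dot H for idfun}).
Variables (f : H -> R^o) (psi : H -> \bar R) (Hop : H -> H -> (H -> R^o)).

Definition objective (x : H) : \bar R := ((f x)%:E + psi x)%E.

Definition dom_objective : set H := [set x | (objective x < +oo)%E].

Definition sublevel (x0 : H) : set H :=
  [set x | dom_objective x /\ (objective x <= objective x0)%E].

Definition solution_set (Fstar : R) : set H :=
  [set x | objective x = Fstar%:E].

Definition model (lambda : R) (x y : H) : \bar R :=
  ((f x + frechet f x (y - x) + 2^-1 * Hop x (y - x) (y - x)
    + lambda / 2 * `|y - x| ^+ 2)%:E + psi y)%E.

Definition psi_prime (lambda : R) (x xp : H) : H -> R^o :=
  - frechet f x - Hop x (xp - x) - lambda *: riesz ip (xp - x).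

Definition F_prime (lambda : R) (x xp : H) : H -> R^o :=
  frechet f xp + psi_prime lambda x xp.

Definition admissible (lambda : R) (x xp : H) : Prop :=
  subdifferential psi xp (psi_prime lambda x xp) /\
  (model lambda x xp <= model lambda x x)%E.

Definition subproblem_solvable (L : R) : Prop :=
  forall (lambda : R) (x : H), L <= lambda -> dom_objective x ->
    exists xp, admissible lambda x xp.

Definition accepted (alpha beta lambda : R) (x xp : H) : Prop :=
  alpha / lambda * dual_norm (F_prime lambda x xp) ^+ 2
    <= F_prime lambda x xp (x - xp) /\
  ((beta * lambda * `|xp - x| ^+ 2)%:E <= objective x - objective xp)%E.

(* A run of the algorithm.  attempt k j is the outcome of the attempt to solve
   the subproblem at x k with lambda = 2 ^+ j * Lam k, None standing for an
   attempt that was not successful; js k is the index of the accepted trial. *)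
Record leap_ssn_run (alpha beta Lam0 : R) (x0 : H)
    (attempt : nat -> nat -> option H)
    (x : nat -> H) (js : nat -> nat) (lam Lam : nat -> R) : Prop := {
  run_x0 : x 0%N = x0 ;
  run_Lam0 : Lam 0%N = Lam0 ;
  run_rejected : forall k j, (j < js k)%N ->
    forall xp, attempt k j = Some xp ->
      admissible (2 ^+ j * Lam k) (x k) xp /\
      ~ accepted alpha beta (2 ^+ j * Lam k) (x k) xp ;
  run_accepted : forall k,
    [/\ attempt k (js k) = Some (x k.+1),
        admissible (lam k) (x k) (x k.+1) &
        accepted alpha beta (lam k) (x k) (x k.+1)] ;
  run_lam : forall k, lam k = 2 ^+ js k * Lam k ;
  run_Lam : forall k, Lam k.+1 = lam k / 2
}.

(* The subproblem assumption requires admissible solutions for lambda >= L to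
   exist and to be computable: this is the second part, along a run. *)
Definition attempts_succeed (L : R) (attempt : nat -> nat -> option H)
    (js : nat -> nat) (Lam : nat -> R) : Prop :=
  forall k j, (j <= js k)%N -> L <= 2 ^+ j * Lam k -> attempt k j <> None.

End LeAPSSN.

(* Iteration i runs through the trials 0, ..., js i and counts for js i steps:
   the accepted trial is not counted on top of the js i trials before it.
   Counting it as well would add k.+1, and the bound
   k + 1 + log2 (max (1/2) (m * L / Lam0)) would fail, for instance as soon as
   2 * m * L <= Lam0 and every trial j = 0 is accepted. *)
Definition newton_steps (js : nat -> nat) (k : nat) : nat :=
  (\sum_(i < k.+1) js i)%N.

Definition log2 {R : realType} (t : R) : R := ln t / ln 2.

(* Main.v *)
Require Import Defs.
From HB Require Import structures.
From mathcomp Require Import all_boot all_order all_algebra.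
From mathcomp Require Import sesquilinear.
From mathcomp Require Import all_classical all_reals all_analysis.
From mathcomp Require Import ring lra.

Set Implicit Arguments.
Unset Strict Implicit.
Unset Printing Implicit Defensive.
Import Order.TTheory GRing.Theory Num.Theory.
Import numFieldNormedType.Exports.
Local Open Scope classical_set_scope.
Local Open Scope ring_scope.

(** Write [a_k = F(x_k) - F^*] and [g_k = ||F'(x_k)||_*].

    Acceptance.  At a trial with [lambda >= m L] both tests hold.  The
    residual [f'(x_+) - f'(x) - H(x)(x_+ - x)] has norm at most [L ||x_+ - x||]
    and equals [F'(x_+) + lambda R (x_+ - x)]; expanding its squared norm
    gives the gradient test ([accepted_of_large_lambda], with the expansion in
    [dual_norm_pythagoras]).  Integrating the residual along the segment gives
    an upper Taylor bound with remainder [L/2 ||x_+ - x||^2], and this together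
    with the descent of the model gives the decrease test.  So a rejected or
    failed trial has [lambda < m L], and an accepted one has
    [lambda_k <= max (2 m L) Lambda_0] ([run_lam_le]).

    Rate.  Convexity of [F] on the sublevel set yields [a_k <= g_k D_0] and
    [a_k - a_{k+1} >= <F'(x_{k+1}), x_k - x_{k+1}> >= alpha/lambda_k g_{k+1}^2]
    ([composite_subgradient]), and the rest concerns sequences of reals
    ([gap_decay_rate]).  Dividing the decrease by [a_k^2 <= g_k^2 D_0^2] gives
    [1/a_{k+1} - 1/a_k >= c (g_{k+1}/g_k)^2] with [c = alpha / (M D_0^2)],
    where [M] bounds the [lambda_k].  If [g_k <= g_0 exp (-k/4)], then
    [a_k <= g_k D_0] is already the first term of the bound.  Otherwise the
    product of the ratios [g_{i+1}/g_i] is at least [exp (-k/4)], the sum of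
    their squares is at least [k exp (-1/2) >= k/2], and [1/a_k >= c k/2],
    which is the second term.

    When [lambda_k -> 0], the rate applied from a late iteration on has an
    arbitrarily small [M], whence [o(1/k)] ([gap_decay_littleo]).

    Newton steps.  Each trial after the first doubles [lambda] and each
    iteration halves it once, so [2^(k+1) Lambda_{k+1} = 2^steps Lambda_0]; the
    bound on [lambda_k = 2 Lambda_{k+1}] then bounds the number of steps. *)

(** * The dual norm *)

Section DualNorm.
Context {R : realType} {H : completeNormedModType R}.
Implicit Types (phi psi : H -> R^o) (u v : H) (a : R).

Lemma in_dualD phi psi : in_dual phi -> in_dual psi -> in_dual (phi + psi).
Proof.
move=> [lp cp] [lq cq]; split; last by move=> v; apply: cvgD; [exact: cp|exact: cq].
move=> a u v; rewrite !fctE lp lq /=.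
by rewrite scalerDr addrACA.
Qed.

Lemma in_dualZ a phi : in_dual phi -> in_dual (a *: phi).
Proof.
move=> [lp cp]; split; last by move=> v; apply: cvgZl_tmp; exact: cp.
by move=> b u v; rewrite !fctE lp scalerDr !scalerA mulrC.
Qed.

Lemma in_dualN phi : in_dual phi -> in_dual (- phi).
Proof. by rewrite -scaleN1r; exact: in_dualZ. Qed.

Lemma in_dual0E phi : in_dual phi -> phi 0 = 0.
Proof.
move=> [lp _]; have := lp (-1) 0 0.
by rewrite scaler0 addr0 => ->; rewrite scaleN1r addNr.
Qed.

Lemma in_dualDE phi u v : in_dual phi -> phi (u + v) = phi u + phi v.
Proof. by move=> [lp _]; rewrite -[u]scale1r lp !scale1r. Qed.

Lemma in_dualZE phi a v : in_dual phi -> phi (a *: v) = a * phi v.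
Proof. by move=> dp; rewrite -[X in phi X]addr0 dp.1 in_dual0E// addr0. Qed.

Lemma in_dualNE phi v : in_dual phi -> phi (- v) = - phi v.
Proof. by move=> dp; rewrite -scaleN1r in_dualZE// mulN1r. Qed.

Lemma in_dual_bounded phi : in_dual phi ->
  exists2 M : R, 0 < M & forall v, `|phi v| <= M * `|v|.
Proof.
move=> [lp cp].
pose g : {linear H -> R^o} := HB.pack phi (GRing.isLinear.Build R H R^o _ phi lp).
have /linear_boundedP : bounded_near g (nbhs 0).
  by apply/linear_bounded_continuous.
move=> [M [_ Mb]]; exists (`|M| + 1); first by rewrite ltr_wpDl.
by apply: Mb; rewrite (le_lt_trans (ler_norm M))// ltrDl.
Qed.

(** For elements of the dual, [dual_norm] is thus a genuine supremum rather
    than the default value of [sup]. *)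
Lemma dual_norm_has_sup phi : in_dual phi ->
  has_sup [set `|phi v| | v in [set v | `|v| <= 1]].
Proof.
move=> dp; split; first by exists `|phi 0|, 0; rewrite /= ?normr0.
have [M M0 Mb] := in_dual_bounded dp; exists M => _ [v /= v1 <-].
by rewrite (le_trans (Mb v))// ler_piMr// ltW.
Qed.

Lemma dual_norm_ge0 phi : in_dual phi -> 0 <= dual_norm phi.
Proof.
move=> dp; rewrite (le_trans (normr_ge0 (phi 0)))//.
by apply: ub_le_sup; [have [] := dual_norm_has_sup dp|exists 0; rewrite /= ?normr0].
Qed.

Lemma le_dual_norm phi v : in_dual phi -> `|phi v| <= dual_norm phi * `|v|.
Proof.
move=> dp; have [->|v0] := eqVneq v 0.
  by rewrite in_dual0E// !normr0 mulr0.
have nv : 0 < `|v| by rewrite normr_gt0.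
rewrite -ler_pdivrMr//.
have -> : `|phi v| / `|v| = `|phi (`|v|^-1 *: v)|.
  by rewrite in_dualZE// normrM normfV normr_id mulrC.
apply: ub_le_sup; first by have [] := dual_norm_has_sup dp.
by exists (`|v|^-1 *: v) => //=; rewrite normrZ normfV normr_id mulVf// gt_eqF.
Qed.

Lemma dual_norm_le phi M : in_dual phi ->
  (forall v, `|v| <= 1 -> `|phi v| <= M) -> dual_norm phi <= M.
Proof.
move=> dp hM; apply: ge_sup; first by have [] := dual_norm_has_sup dp.
by move=> _ [v /= v1 <-]; exact: hM.
Qed.

Context (ip : {dot H for idfun}) (hip : forall v : H, ip v v = `|v| ^+ 2).

Lemma ipC u v : ip u v = ip v u.
Proof. by rewrite hermC expr0 mul1r. Qed.

Lemma normD_sqr a b u v :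
  `|a *: u + b *: v| ^+ 2
    = a ^+ 2 * `|u| ^+ 2 + 2 * a * b * ip u v + b ^+ 2 * `|v| ^+ 2.
Proof.
rewrite -!hip linearDl !linearDr /= !linearZl_LR /= !linearZr_LR /= (ipC v u).
by rewrite /GRing.scale /=; ring.
Qed.

Lemma cauchy_schwarz u v : `|ip u v| <= `|u| * `|v|.
Proof.
have h (s : R) : s ^+ 2 = 1 -> s * ip u v <= `|u| * `|v|.
  move=> s1.
  (* This vector vanishes in the case of equality [ip u v = s * `|u| * `|v|]. *)
  have : `|(`|v|) *: u + (- s * `|u|) *: v| ^+ 2 >= 0 by rewrite exprn_ge0.
  rewrite normD_sqr => h.
  have [u0|u0] := eqVneq u 0; first by rewrite u0 linear0l normr0 mulr0 mul0r.
  have [v0|v0] := eqVneq v 0; first by rewrite v0 linear0r normr0 !mulr0.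
  have pu : 0 < `|u| by rewrite normr_gt0.
  have pv : 0 < `|v| by rewrite normr_gt0.
  have p : 0 < `|u| * `|v| by rewrite mulr_gt0.
  rewrite -(ler_pM2l p).
  move: h; rewrite exprMn sqrrN s1; lra.
rewrite ler_norml; have := h 1 (expr1n _ _); have := h (-1) (sqrr_sign _ 1).
lra.
Qed.

Lemma in_dual_riesz u : in_dual (riesz ip u).
Proof.
have lr : linear (riesz ip u).
  by move=> a v w; rewrite /riesz linearPr.
split=> //.
pose g : {linear H -> R^o} :=
  HB.pack (riesz ip u) (GRing.isLinear.Build R H R^o _ (riesz ip u) lr).
suff : continuous g by [].
apply/linear_bounded_continuous/linear_boundedP.
exists `|u|; split; first exact: num_real.
move=> M uM v; rewrite (le_trans (cauchy_schwarz u v))//.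
by rewrite ler_wpM2r// ltW.
Qed.

(** The squared norm of a sum, expanded.  If [phi] is represented by [p], the
    sum is represented by [p + a *: u]; since only values [phi v] with
    [`|v| <= 1] enter the norm of [phi], it suffices to evaluate the sum at
    [phi v *: v + a *: u], which stands for [p + a *: u] without appealing to
    the representation theorem. *)
Lemma dual_norm_pythagoras phi a u : in_dual phi ->
  dual_norm phi ^+ 2 + 2 * a * phi u + a ^+ 2 * `|u| ^+ 2
    <= dual_norm (phi + a *: riesz ip u) ^+ 2.
Proof.
move=> dp; set e := phi + _; set E := dual_norm e.
have de : in_dual e by apply: in_dualD => //; exact/in_dualZ/in_dual_riesz.
have key v : `|v| <= 1 ->
    `|phi v| ^+ 2 <= E ^+ 2 - 2 * a * phi u - a ^+ 2 * `|u| ^+ 2.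
  move=> v1; pose w := phi v *: v + a *: u.
  have ew : e w = phi v ^+ 2 + a * phi u + a * (phi v * ip u v) + a ^+ 2 * `|u| ^+ 2.
    rewrite /e /w !fctE /riesz in_dualDE// !in_dualZE// linearDr /= !linearZr_LR /=.
    by rewrite hip /GRing.scale/=; ring.
  have nw := normD_sqr (phi v) a v u; rewrite -/w (ipC v u) in nw.
  have := le_trans (ler_norm _) (le_dual_norm w de); rewrite ew -/E => h.
  (* [E * `|w| <= (E ^+ 2 + `|w| ^+ 2) / 2], by which [w] need not be
     normalised. *)
  have h2 : 0 <= (E - `|w|) ^+ 2 by exact: sqr_ge0.
  have h3 : phi v ^+ 2 * `|v| ^+ 2 <= phi v ^+ 2.
    by rewrite ler_piMr ?sqr_ge0// expr_le1.
  by rewrite real_normK ?num_real//; lra.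
have rhs0 : 0 <= E ^+ 2 - 2 * a * phi u - a ^+ 2 * `|u| ^+ 2.
  by rewrite (le_trans _ (key 0 _)) ?normr0// sqr_ge0.
have : dual_norm phi <= Num.sqrt (E ^+ 2 - 2 * a * phi u - a ^+ 2 * `|u| ^+ 2).
  apply: dual_norm_le => // v /key h.
  by rewrite -(ger0_norm (normr_ge0 (phi v))) -sqrtr_sqr ler_wsqrtr.
move=> h; have := lerXn2r 2 (dual_norm_ge0 dp : _ \is Num.nneg)
  (sqrtr_ge0 _ : _ \is Num.nneg) h.
by rewrite sqr_sqrtr//; lra.
Qed.

End DualNorm.

(** * Taylor bound along a segment *)

Section SmoothPart.
Context {R : realType} {H : completeNormedModType R}.
Implicit Types (f : H -> R^o) (x r : H).

Lemma in_dual_frechet f x : differentiable f x -> in_dual (frechet f x).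
Proof.
move=> df; split; last exact: diff_continuous.
by move=> a u v; rewrite /frechet linearP.
Qed.

(** The difference quotients of [s |-> f (x + s *: r)] at [t] are literally
    those of [f] at [x + t *: r] in the direction [r]. *)
Lemma derive_along_line f x r (t : R) : differentiable f (x + t *: r) ->
  is_derive t 1 (fun s : R => f (x + s *: r)) (frechet f (x + t *: r) r).
Proof.
move=> df; have dv := diff_derivable (v := r) df.
have eqf : (fun h : R => h^-1 *:
      (((fun s : R => f (x + s *: r)) \o shift t) (h *: (1 : R))
      - f (x + t *: r))) =
    (fun h : R => h^-1 *: ((f \o shift (x + t *: r)) (h *: r) - f (x + t *: r))).
  apply/funext => h /=; congr (_ *: (f _ - _)).
  by rewrite [h *: 1]mulr1 scalerDl addrCA.
split; first by rewrite /derivable eqf.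
by rewrite /derive eqf -[RHS]deriveE.
Qed.

(** Semismoothness-type control of [f'] by the linear maps [B] integrates to a
    second-order upper model: the difference [g] of [f (x + t *: r)] and that
    model has derivative [(f' (x + t *: r) - f' x - B (t *: r)) r], minus
    [L * t * `|r| ^+ 2], which is nonpositive.  The mean value theorem on
    [[0, 1]] replaces the integral. *)
Lemma taylor_upper_bound f (B : H -> H -> R^o) x (L : R) :
  (forall y, differentiable f y) -> linear B -> (forall u, in_dual (B u)) ->
  (forall y, dual_norm (frechet f y - frechet f x - B (y - x)) <= L * `|x - y|) ->
  forall r, f (x + r) <= f x + frechet f x r + 2^-1 * B r r + L / 2 * `|r| ^+ 2.
Proof.
move=> df lB dB hL r.
pose c0 := frechet f x r; pose c1 := B r r + L * `|r| ^+ 2.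
pose g t := f (x + t *: r) - (t * c0 + 2^-1 * c1 * (t * t)).
pose dg t := frechet f (x + t *: r) r - (c0 + c1 * t).
have gd (t : R) : is_derive t 1 g (dg t).
  have hf := derive_along_line (df (x + t *: r)).
  apply: is_derive_eq.
  rewrite /dg /GRing.scale/= ; lra.
have [c c01 ->] : exists2 c, c \in `]0, 1[ & f (x + r) = g 0 + dg c + c0 + 2^-1 * c1.
  have cg : {within `[0 : R, 1], continuous g}.
    apply: continuous_subspaceT => t.
    by apply: differentiable_continuous; apply/derivable1_diffP; case: (gd t).
  have [c c01 hc] := MVT ltr01 (fun t _ => gd t) cg.
  exists c => //; move: hc; rewrite /g scale1r; lra.
move: c01; rewrite in_itv/= => /andP[c0_ c1_].
have lBc : B (c *: r) r = c * B r r.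
  rewrite -[c *: r]addr0 lB fctE.
  suff -> : B 0 = 0 by rewrite addr0.
  by have := lB (-1) 0 0; rewrite scaler0 addr0 scaleN1r addNr.
have dd : in_dual (frechet f (x + c *: r) - frechet f x - B (c *: r)).
  have dfr y : in_dual (frechet f y) by exact: in_dual_frechet.
  by apply: in_dualD; [apply: in_dualD => //|]; exact: in_dualN.
have := hL (x + c *: r).
rewrite [x + _ - x]addrC addKr opprD addNKr normrN normrZ gtr0_norm// => hn.
have := le_trans (ler_norm _) (le_dual_norm r dd); rewrite !fctE lBc.
have := ler_wpM2r (normr_ge0 r) hn.
rewrite /g /dg /c0 /c1 scale0r addr0; lra.
Qed.

End SmoothPart.

(** * Subgradients of the composite objective and acceptance of trials *)

Section CompositeObjective.
Context {R : realType} {H : completeNormedModType R}.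
Variables (f : H -> R^o) (psi : H -> \bar R).
Implicit Types (p q : H) (phi : H -> R^o).

Lemma objective_fin_num p : proper_fun psi -> dom_objective f psi p ->
  objective f psi p \is a fin_num.
Proof.
move=> [psiN _]; rewrite /dom_objective /objective /= => h.
rewrite fin_numE; apply/andP; split; last by rewrite lt_eqF.
by move: (psiN p); case: (psi p).
Qed.

(** Convexity is that of the sum, not of [f].  On the segment from [p] to [q]
    it bounds the difference quotients of the sum by [b - a]; those of [psi]
    are at least [phi (q - p)], and those of [f] tend to [f' p (q - p)]. *)
Lemma composite_subgradient (A : set H) p q phi (a b : R) :
  differentiable f p -> convex_on A (objective f psi) -> A p -> A q ->
  subdifferential psi p phi ->
  objective f psi p = a%:E -> objective f psi q = b%:E ->
  a - b <= (frechet f p + phi) (p - q).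
Proof.
move=> df cvx Ap Aq [dphi fp sub] Fp Fq.
pose d := q - p.
suff : frechet f p d <= b - a - phi d.
  move=> h; have -> : p - q = - d by rewrite opprB.
  rewrite fctE /= (in_dualNE _ (in_dual_frechet df)) in_dualNE//.
  lra.
have dd := diff_derivable (v := d) df.
have /cvg_dnbhs_at_right cv : h^-1 *: (f (h *: d + p) - f p) @[h --> (0:R)^']
    --> (frechet f p d : R^o).
  by have := dd; rewrite /derivable /frechet -deriveE.
apply: (cvgr_to_le cv); near=> h.
have h0 : 0 < h by [].
have h1 : h <= 1 by near: h; exact: nbhs_right_le.
have := cvx q p Aq Ap h; rewrite (ltW h0) h1 => /(_ isT).
have -> : h *: q + (1 - h) *: p = h *: d + p.
  by rewrite /d scalerBr scalerBl scale1r addrCA addrC.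
rewrite Fp Fq /objective; have := sub (h *: d + p).
rewrite addrK in_dualZE//.
move: Fp; rewrite /objective.
case: (psi p) fp => // s _ [sa].
case: (psi (h *: d + p)) => // s'; rewrite -!EFinM -!EFinD !lee_fin => e1 e2.
rewrite /GRing.scale/= ler_pdivrMl//; lra.
Unshelve. all: by end_near.
Qed.

End CompositeObjective.

Section Acceptance.
Context {R : realType} {H : completeNormedModType R}.
Variables (ip : {dot H for idfun}) (hip : forall v : H, ip v v = `|v| ^+ 2).
Variables (f : H -> R^o) (psi : H -> \bar R) (Hop : H -> H -> (H -> R^o)).

Lemma in_dual_F_prime lambda x xp : differentiable f xp ->
  admissible ip f psi Hop lambda x xp -> in_dual (F_prime ip f Hop lambda x xp).
Proof. by move=> df [[dp _ _] _]; apply: in_dualD => //; exact: in_dual_frechet. Qed.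

(** The gradient test uses [lambda >= L] and [alpha <= 1/2], because it amounts
    to dropping [(lambda ^+ 2 - L ^+ 2) * `|xp - x| ^+ 2 >= 0]; the factor [m]
    serves the decrease test, where [(lambda - L) / 2] has to dominate
    [beta * lambda]. *)
Lemma accepted_of_large_lambda (L alpha m beta lambda : R) x xp :
  (forall y, differentiable f y) -> proper_fun psi ->
  sym_bounded_operator (Hop x) -> 0 <= L ->
  (forall y, dual_norm (frechet f y - frechet f x - Hop x (y - x)) <= L * `|x - y|) ->
  alpha <= 2^-1 -> 1 <= m -> beta <= (m - 1) / (2 * m) ->
  0 < lambda -> m * L <= lambda -> dom_objective f psi x ->
  admissible ip f psi Hop lambda x xp ->
  accepted ip f psi Hop alpha beta lambda x xp.
Proof.
move=> df pr [lB dB _ _] L0 hL al m1 be l0 ml dx adm.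
have [[dpsi fxp _] decr] := adm.
have dF := in_dual_F_prime (df xp) adm.
pose r := xp - x; have xpE : xp = x + r by rewrite addrC subrK.
have nr : `|x - xp| = `|r| by rewrite distrC.
split.
  have /(dual_norm_pythagoras hip lambda r) := dF.
  have -> : F_prime ip f Hop lambda x xp + lambda *: riesz ip r =
      frechet f xp - frechet f x - Hop x r.
    by rewrite /F_prime /psi_prime -/r !addrA subrK.
  set phi := F_prime _ _ _ _ _ _ => pyth.
  have e0 : 0 <= dual_norm (frechet f xp - frechet f x - Hop x r).
    apply: dual_norm_ge0; have dfr y : in_dual (frechet f y) by exact: in_dual_frechet.
    by apply: in_dualD; [apply: in_dualD => //|]; exact: in_dualN.
  have := hL xp; rewrite nr -/r => he.
  have he2 := lerXn2r 2 (e0 : _ \is Num.nneg)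
    (mulr_ge0 L0 (normr_ge0 r) : _ \is Num.nneg) he.
  have Ll : L <= lambda by rewrite (le_trans _ ml)// ler_peMl.
  have L2 : (L * `|r|) ^+ 2 <= lambda ^+ 2 * `|r| ^+ 2.
    rewrite exprMn ler_wpM2r ?sqr_ge0// lerXn2r// nnegrE//; lra.
  rewrite -[x - xp]opprB -/r in_dualNE// mulrAC ler_pdivrMr//.
  have : alpha * dual_norm phi ^+ 2 <= 2^-1 * dual_norm phi ^+ 2.
    by rewrite ler_wpM2r ?sqr_ge0.
  lra.
have ty := taylor_upper_bound df lB dB hL r; rewrite -xpE in ty.
have hb : beta * lambda <= (lambda - L) / 2.
  have mg : 0 < m by lra.
  have : beta * lambda <= (m - 1) / (2 * m) * lambda by rewrite ler_wpM2r// ltW.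
  have -> : (m - 1) / (2 * m) * lambda = (lambda - lambda / m) / 2 by field; lra.
  have : L <= lambda / m by rewrite ler_pdivlMr// mulrC.
  lra.
have hb2 := ler_wpM2r (sqr_ge0 `|r|) hb.
have hx := objective_fin_num pr dx.
move: hx decr; rewrite /model /objective subrr normr0 expr0n /= -/r.
rewrite (in_dual0E (in_dual_frechet (df x))) (in_dual0E (dB 0)).
case: (psi x) => // s _; case: (psi xp) fxp => // s' _.
rewrite -!EFinD !lee_fin; lra.
Qed.

End Acceptance.

(** * Decay of the gap, for sequences of reals *)

Section RateOfSequences.
Context {R : realType}.

(** The exponential term covers the case where [g] has already dropped by the
    factor [expR (- (k / 4))].  In the other case the inverses of the [a i]
    grow by [c * (g i.+1 / g i) ^+ 2] per step.  The sum of the squared ratios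
    is bounded below through their product, by the tangent inequality
    [1 + y <= expR y] instead of the inequality of the two means. *)
Lemma gap_decay_rate (a g lam : nat -> R) (alpha D M : R) :
  0 < alpha -> 0 <= D -> (forall k, 0 < lam k <= M) ->
  (forall k, 0 <= a k) -> (forall k, 0 <= g k) ->
  (forall k, a k <= g k * D) ->
  (forall k, alpha / lam k * g k.+1 ^+ 2 <= a k - a k.+1) ->
  forall k, (0 < k)%N ->
    a k <= g 0%N * D * expR (- (k%:R / 4)) + 2 * D ^+ 2 * M / (alpha * k%:R).
Proof.
move=> al0 D0 hl a0 g0 ag dec k k0.
have M0 : 0 < M by have /andP[] := hl 0%N; exact: lt_le_trans.
have K0 : 0 < k%:R :> R by rewrite ltr0n.
have t10 : 0 <= g 0%N * D * expR (- (k%:R / 4)) by rewrite !mulr_ge0 ?expR_ge0.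
have t20 : 0 <= 2 * D ^+ 2 * M / (alpha * k%:R).
  by rewrite divr_ge0 ?mulr_ge0 ?sqr_ge0// ltW// ltW.
have [small|large] := leP (g k) (g 0%N * expR (- (k%:R / 4))).
  apply: (le_trans (ag k)); apply: (@le_trans _ _ (g 0%N * D * expR (- (k%:R / 4)))).
    by rewrite mulrAC ler_wpM2r.
  by rewrite lerDl.
have [ak0|akN] := leP (a k) 0; first by rewrite (le_trans ak0)// addr_ge0.
have amono i j : (i <= j)%N -> a j <= a i.
  elim: j => [|j IH]; first by rewrite leqn0 => /eqP ->.
  rewrite leq_eqVlt => /orP[/eqP -> //|]; rewrite ltnS => /IH; apply: le_trans.
  have := dec j; have : 0 <= alpha / lam j * g j.+1 ^+ 2.
    by have /andP[lj _] := hl j; rewrite mulr_ge0 ?sqr_ge0// divr_ge0 ?ltW.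
  by lra.
have apos i : (i <= k)%N -> 0 < a i by move=> /amono; exact: lt_le_trans.
have D_gt0 : 0 < D.
  rewrite lt_neqAle D0 andbT eq_sym; apply/eqP => De.
  by have := ag k; rewrite De mulr0 leNgt akN.
have gpos i : (i <= k)%N -> 0 < g i.
  move=> ik; rewrite lt_neqAle g0 andbT eq_sym; apply/eqP => ge.
  by have := ag i; rewrite ge mul0r leNgt apos.
pose c := alpha / (M * D ^+ 2).
have c0 : 0 < c by rewrite divr_gt0// mulr_gt0// exprn_gt0.
pose s := expR (- 2^-1) : R.
have step i : (i < k)%N ->
   (a i)^-1 + c * (s * (3 / 2 + 2 * (ln (g i.+1) - ln (g i)))) <= (a i.+1)^-1.
  move=> ik; have pi := apos _ (ltnW ik); have pi1 := apos _ ik.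
  have gi := gpos _ (ltnW ik); have gi1 := gpos _ ik.
  pose t := g i.+1 / g i; have t0 : 0 < t by rewrite divr_gt0.
  have lnt : ln t = ln (g i.+1) - ln (g i) by rewrite ln_div.
  (* Tangent of [expR] at [0], applied to [ln (t ^+ 2) + 1 / 2]: with this
     shift equality holds at [t ^+ 2 = s], the value taken when all [k] ratios
     are equal and [g k = g 0 * expR (- (k / 4))]. *)
  have st : s * (3 / 2 + 2 * ln t) <= t ^+ 2.
    have -> : t ^+ 2 = s * expR (2^-1 + 2 * ln t).
      rewrite -expRD addKr mulr_natl mulr2n expRD lnK//.
    rewrite ler_pM2l ?expR_gt0//.
    have := expR_ge1Dx (2^-1 + 2 * ln t); lra.
  rewrite -lnt; apply: (@le_trans _ _ ((a i)^-1 + c * t ^+ 2)).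
    by rewrite lerD2l ler_pM2l.
  have h1 : c * t ^+ 2 * a i ^+ 2 <= a i - a i.+1.
    apply: le_trans (dec i).
    have /andP[li liM] := hl i.
    have -> : c * t ^+ 2 * a i ^+ 2 = alpha / M * g i.+1 ^+ 2 * (a i / (g i * D)) ^+ 2.
      by rewrite /c /t; field; rewrite !gt_eqF.
    have q1 : (a i / (g i * D)) ^+ 2 <= 1.
      have q0 : 0 <= a i / (g i * D) by rewrite divr_ge0// mulr_ge0.
      by rewrite expr_le1// ler_pdivrMr ?mulr_gt0// mul1r.
    apply: (@le_trans _ _ (alpha / M * g i.+1 ^+ 2)).
      by apply: ler_piMr => //; rewrite mulr_ge0 ?sqr_ge0// divr_ge0 ?ltW.
    by rewrite ler_wpM2r ?sqr_ge0// ler_pM2l// lef_pV2.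
  have h2 : a i.+1 <= a i by exact: amono.
  rewrite -lerBrDl.
  have -> : (a i.+1)^-1 - (a i)^-1 = (a i - a i.+1) / (a i.+1 * a i).
    by field; rewrite !gt_eqF.
  rewrite ler_pdivlMr ?mulr_gt0//; apply: le_trans h1.
  have ct0 : 0 <= c * t ^+ 2 by rewrite mulr_ge0 ?sqr_ge0// ltW.
  by apply: ler_wpM2l => //; rewrite expr2 ler_pM2r.
have tele n : (n <= k)%N ->
   (a 0%N)^-1 + c * (s * (3 / 2 * n%:R + 2 * (ln (g n) - ln (g 0%N)))) <= (a n)^-1.
  elim: n => [_|n IH nk]; first by rewrite subrr !mulr0 addr0 !mulr0 addr0.
  apply: le_trans (step _ nk); have := IH (ltnW nk); rewrite -natr1; lra.
have lng : - (k%:R / 4) <= ln (g k) - ln (g 0%N).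
  have g00 := gpos 0%N isT.
  rewrite -ln_div ?posrE ?gpos// -[X in X <= _]expRK.
  rewrite ler_ln ?posrE ?expR_gt0 ?divr_gt0 ?gpos//.
  by rewrite ler_pdivlMr// mulrC ltW.
have s0 : 0 < s by exact: expR_gt0.
have ik : c * (s * k%:R) <= (a k)^-1.
  apply: le_trans (tele _ (leqnn k)).
  have : 0 < (a 0%N)^-1 by rewrite invr_gt0 apos.
  have : c * (s * k%:R) <= c * (s * (3 / 2 * k%:R + 2 * (ln (g k) - ln (g 0%N)))).
    by rewrite ler_pM2l// ler_pM2l//; lra.
  lra.
have s2 : 2^-1 <= s by have := expR_ge1Dx (- 2^-1 : R); rewrite -/s; lra.
have : c * (2^-1 * k%:R) <= (a k)^-1.
  by apply: le_trans ik; rewrite ler_pM2l// ler_pM2r.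
have ck : 0 < c * (2^-1 * k%:R) by rewrite mulr_gt0// mulr_gt0// invr_gt0.
rewrite -[X in X <= _]invrK lef_pV2 ?posrE ?invr_gt0// => h.
have -> : 2 * D ^+ 2 * M / (alpha * k%:R) = (c * (2^-1 * k%:R))^-1.
  move: (k%:R) K0 => K K0; rewrite /c; field.
  by rewrite !gt_eqF.
lra.
Qed.

(** From an index [N] on, [lam] is at most a given [delta], and the rate started at
    [N] applies with [M = delta].  After [k > 2 N] steps at least [k / 2] of
    them are past [N], so the second term is at most [4 D^2 delta / (alpha k)];
    the exponential term is [O(1/k^2)]. *)
Lemma gap_decay_littleo (a g lam : nat -> R) (alpha D : R) :
  0 < alpha -> 0 <= D -> (forall k, 0 < lam k) -> lam @ \oo --> (0 : R) ->
  (forall k, 0 <= a k) -> (forall k, 0 <= g k) ->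
  (forall k, a k <= g k * D) ->
  (forall k, alpha / lam k * g k.+1 ^+ 2 <= a k - a k.+1) ->
  (a : nat -> R^o) =o_\oo (fun k : nat => k%:R^-1 : R^o).
Proof.
move=> al0 D0 l0 lcv a0 g0 ag dec; apply/eqoP => eps eps0.
(* Makes the second term at most [eps / (2 k)]; the [+ 1] covers [D = 0]. *)
pose delta := eps * alpha / (8 * (D ^+ 2 + 1)).
have D2 : 0 < D ^+ 2 + 1 by rewrite ltr_wpDl ?sqr_ge0.
have d0 : 0 < delta by rewrite !divr_gt0 ?mulr_gt0.
have [N _ hN] : \forall n \near \oo, lam n <= delta.
  by move/cvgrPdist_le : lcv => /(_ _ d0); apply: filterS => n;
     rewrite sub0r normrN gtr0_norm.
pose C := g N * D; have C0 : 0 <= C by rewrite mulr_ge0.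
near=> k.
have kN : (2 * N < k)%N by near: k; exact: nbhs_infty_gt.
have kC : C * 256 / eps <= k%:R by near: k; exact: nbhs_infty_ger.
have [n n0 kE] : exists2 n, (0 < n)%N & k = (N + n)%N.
  exists (k - N)%N; first by rewrite subn_gt0 (leq_ltn_trans _ kN)// leq_pmull.
  by rewrite subnKC// ltnW// (leq_ltn_trans _ kN)// leq_pmull.
have k0 : 0 < k%:R :> R by rewrite ltr0n (leq_ltn_trans _ kN).
have n0R : 0 < n%:R :> R by rewrite ltr0n.
have kn : k%:R <= 2 * n%:R :> R.
  rewrite -natrM ler_nat; move: kN; rewrite kE !mul2n -!addnn.
  by rewrite ltn_add2l leq_add2r => /ltnW.
rewrite ger0_norm// ger0_norm ?invr_ge0 ?ler0n//.
have := @gap_decay_rate (fun i => a (N + i)%N) (fun i => g (N + i)%N)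
  (fun i => lam (N + i)%N) alpha D delta al0 D0.
move=> /(_ _ _ _ _ _ n n0) rate; apply: (@le_trans _ _ (C * expR (- (n%:R / 4))
    + 2 * D ^+ 2 * delta / (alpha * n%:R))).
  rewrite kE; have := rate; rewrite addn0; apply => // i.
  - by rewrite l0; apply: hN; rewrite /= leq_addr.
  - by rewrite addnS.
have e1 : C * expR (- (n%:R / 4)) <= eps / 2 / k%:R.
  rewrite expRN ler_pdivrMr ?expR_gt0//.
  have ex : k%:R ^+ 2 / 128 <= expR (n%:R / 4) :> R.
    have n4 : 0 <= n%:R / 4 :> R by rewrite divr_ge0// ltW.
    have := expR_ge1Dxn 1 n4; rewrite (_ : 2`! = 2%N)//.
    have : k%:R ^+ 2 <= (2 * n%:R) ^+ 2 :> R by rewrite lerXn2r// nnegrE ltW// mulr_gt0.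
    lra.
  have h := ler_wpM2l (ltW (divr_gt0 (divr_gt0 eps0 (ltr0n R 2)) k0)) ex.
  apply: le_trans h.
  have -> : eps / 2 / k%:R * (k%:R ^+ 2 / 128) = eps * k%:R / 256.
    by move: (k%:R) k0 => K K0; field; rewrite gt_eqF.
  by move: kC; rewrite ler_pdivrMr//; lra.
have e2 : 2 * D ^+ 2 * delta / (alpha * n%:R) <= eps / 2 / k%:R.
  rewrite ler_pdivlMr// mulrAC ler_pdivrMr ?mulr_gt0//.
  have hd : delta * (8 * (D ^+ 2 + 1)) = eps * alpha.
    by rewrite /delta divfK// gt_eqF// mulr_gt0.
  have h1 : D ^+ 2 * delta <= eps * alpha / 8 by rewrite -hd; lra.
  have h2 : D ^+ 2 * delta * k%:R <= eps * alpha / 8 * (2 * n%:R).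
    apply: ler_pM => //.
    by rewrite mulr_ge0 ?sqr_ge0// ltW.
  have h3 : 0 <= eps * alpha * n%:R by rewrite ltW// mulr_gt0// mulr_gt0.
  lra.
have -> : eps * k%:R^-1 = eps / 2 / k%:R + eps / 2 / k%:R by lra.
exact: lerD.
Unshelve. all: by end_near.
Qed.

End RateOfSequences.

(** * Iterates of the algorithm *)

Section Run.
Context {R : realType} {H : completeNormedModType R}.
Variables (ip : {dot H for idfun}).
Variables (f : H -> R^o) (psi : H -> \bar R) (Hop : H -> H -> (H -> R^o)).
Variables (alpha beta Lam0 : R) (x0 : H) (attempt : nat -> nat -> option H).
Variables (x : nat -> H) (js : nat -> nat) (lam Lam : nat -> R).
Hypothesis hrun :
  leap_ssn_run ip f psi Hop alpha beta Lam0 x0 attempt x js lam Lam.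
Hypotheses (psi_proper : proper_fun psi) (hx0 : dom_objective f psi x0).
Hypotheses (Lam0_gt0 : 0 < Lam0) (beta_gt0 : 0 < beta).

Lemma run_Lam_gt0 k : 0 < Lam k.
Proof.
elim: k => [|k IH]; first by rewrite (run_Lam0 hrun).
by rewrite (run_Lam hrun) (run_lam hrun) divr_gt0// mulr_gt0// exprn_gt0.
Qed.

Lemma run_lam_gt0 k : 0 < lam k.
Proof. by rewrite (run_lam hrun) mulr_gt0 ?run_Lam_gt0// exprn_gt0. Qed.

Lemma run_dom k : dom_objective f psi (x k).
Proof.
case: k => [|k]; first by rewrite (run_x0 hrun).
have [_ [[_ fp _] _] _] := run_accepted hrun k.
by rewrite /dom_objective /= /objective; case: (psi _) fp => // s _; rewrite ltry.
Qed.

Lemma run_objective k : objective f psi (x k) = (fine (objective f psi (x k)))%:E.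
Proof. by rewrite fineK// objective_fin_num//; exact: run_dom. Qed.

Lemma run_decrease k :
  fine (objective f psi (x k.+1)) <= fine (objective f psi (x k)).
Proof.
have [_ _ [_]] := run_accepted hrun k.
rewrite (run_objective k) (run_objective k.+1) -EFinD lee_fin.
have : 0 <= beta * lam k * `|x k.+1 - x k| ^+ 2.
  by rewrite mulr_ge0 ?sqr_ge0// mulr_ge0// ltW// run_lam_gt0.
lra.
Qed.

Lemma run_sublevel k : sublevel f psi x0 (x k).
Proof.
split; first exact: run_dom.
rewrite -(run_x0 hrun) [leLHS]run_objective [leRHS]run_objective lee_fin.
elim: k => // k; apply: le_trans; exact: run_decrease.
Qed.

(** If [js k] is positive, the trial just before the accepted one used
    [lam k / 2] and was not accepted, hence [lam k / 2 < T].  Otherwise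
    [lam k] is [Lam0] or half of the preceding value. *)
Lemma run_lam_le (T : R) :
  (forall k j xp, (j < js k)%N -> T <= 2 ^+ j * Lam k ->
    attempt k j = Some xp -> admissible ip f psi Hop (2 ^+ j * Lam k) (x k) xp ->
    accepted ip f psi Hop alpha beta (2 ^+ j * Lam k) (x k) xp) ->
  (forall k j, (j < js k)%N -> T <= 2 ^+ j * Lam k -> attempt k j <> None) ->
  forall k, lam k <= Num.max (2 * T) Lam0.
Proof.
move=> acc att.
have retried k : (0 < js k)%N -> lam k <= 2 * T.
  rewrite (run_lam hrun); case E : (js k) => [//|j] _.
  rewrite exprS -mulrA ler_pM2l// leNgt; apply/negP => lt.
  have jl : (j < js k)%N by rewrite E.
  case A : (attempt k j) => [xp|]; last exact: (att k j jl (ltW lt)).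
  have [adm nacc] := run_rejected hrun jl A.
  by apply: nacc; apply: acc => //; exact: ltW.
move=> k; rewrite le_max; elim: k => [|k IH].
  have [js0|/retried -> //] := posnP (js 0%N).
  by rewrite (run_lam hrun) js0 expr0 mul1r (run_Lam0 hrun) lexx orbT.
have [jsk|/retried -> //] := posnP (js k.+1).
have l0 := run_lam_gt0 k.
rewrite (run_lam hrun) jsk expr0 mul1r (run_Lam hrun).
by move: IH => /orP[] h; apply/orP; [left|right]; lra.
Qed.

(** Every iteration contributes [js i] doublings and one halving. *)
Lemma run_Lam_newton_steps k :
  2 ^+ k.+1 * Lam k.+1 = 2 ^+ newton_steps js k * Lam0.
Proof.
rewrite /newton_steps; elim: k => [|k IH]; rewrite (run_Lam hrun) (run_lam hrun).
  by rewrite big_ord_recr big_ord0 /= (run_Lam0 hrun) expr1; lra.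
rewrite big_ord_recr /= exprD [RHS]mulrAC -IH (exprS 2 k.+1).
by field.
Qed.

Lemma newton_steps_le (T : R) :
  (forall k, lam k <= Num.max (2 * T) Lam0) ->
  forall k, (newton_steps js k)%:R
    <= k%:R + 1 + log2 (Num.max 2^-1 (T / Lam0)) :> R.
Proof.
move=> hl k; set Q := Num.max _ _.
have Q0 : 0 < Q by rewrite lt_max invr_gt0 ltr0n.
have ln2 : 0 < ln 2 :> R by rewrite ln_gt0// ltr1n.
have LQ : Lam k.+1 <= Q * Lam0.
  rewrite (run_Lam hrun) ler_pdivrMr//; apply: (le_trans (hl k)).
  rewrite ge_max; apply/andP; split.
    have : T / Lam0 <= Q by rewrite le_max lexx orbT.
    by rewrite ler_pdivrMr//; lra.
  have : 2^-1 <= Q by rewrite le_max lexx.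
  by rewrite -(ler_pM2r Lam0_gt0); lra.
have : 2 ^+ newton_steps js k * Lam0 <= 2 ^+ k.+1 * Q * Lam0.
  by rewrite -run_Lam_newton_steps -mulrA ler_pM2l// exprn_gt0.
have e2 n : 0 < 2 ^+ n :> R by exact: exprn_gt0.
rewrite ler_pM2r// => hle.
have h : ln (2 ^+ newton_steps js k) <= ln (2 ^+ k.+1 * Q).
  by rewrite ler_ln ?posrE ?mulr_gt0.
have ln2X n : ln (2 ^+ n) = n%:R * ln 2 :> R by rewrite lnXn// mulr_natl.
move: h; rewrite lnM ?posrE// (ln2X (newton_steps js k)) (ln2X k.+1) => h.
rewrite /log2 -(ler_pM2r ln2).
by rewrite natr1 mulrDl divfK ?gt_eqF.
Qed.

End Run.

(** * The convergence theorem *)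

Theorem theorem4p7 (R : realType) (H : completeNormedModType R)
  (ip : {dot H for idfun}) (hip : forall v : H, ip v v = `|v| ^+ 2)
  (f : H -> R^o) (hf : C11 f)
  (psi : H -> \bar R) (psi_proper : proper_fun psi)
  (psi_convex : convex_on setT psi) (psi_lsc : lower_semicontinuous psi)
  (Fstar : R) (Fstar_le : forall x, (Fstar%:E <= objective f psi x)%E)
  (S_nonempty : solution_set f psi Fstar !=set0)
  (Hop : H -> H -> (H -> R^o)) (hHop : forall x, sym_bounded_operator (Hop x))
  (L : R) (L_ge0 : 0 <= L)
  (hL : forall x y : H,
     dual_norm (frechet f y - frechet f x - Hop x (y - x)) <= L * `|x - y|)
  (solvable : subproblem_solvable ip f psi Hop L)
  (alpha : R) (halpha : 0 < alpha <= 2^-1)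
  (m : R) (hm : 1 <= m)
  (beta : R) (hbeta : 0 < beta <= (m - 1) / (2 * m))
  (x0 : H) (hx0 : dom_objective f psi x0)
  (psi'0 : H -> R^o) (hpsi'0 : subdifferential psi x0 psi'0)
  (Lam0 : R) (Lam0_gt0 : 0 < Lam0)
  (attempt : nat -> nat -> option H)
  (x : nat -> H) (js : nat -> nat) (lam Lam : nat -> R)
  (hrun : leap_ssn_run ip f psi Hop alpha beta Lam0 x0 attempt x js lam Lam)
  (computable : attempts_succeed L attempt js Lam)
  (F0_bounded : bounded_set (sublevel f psi x0))
  (F_convex : convex_on (sublevel f psi x0) (objective f psi)) :
  let D0 := diameter (sublevel f psi x0) in
  [/\ forall k : nat, (1 <= k)%N ->
        (objective f psi (x k) - Fstar%:E <=
         (dual_norm (frechet f x0 + psi'0) * D0 * expR (- (k%:R / 4))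
          + 2 * D0 ^+ 2 * Num.max (2 * m * L) Lam0 / (alpha * k%:R))%:E)%E,
      lam @ \oo --> (0 : R) ->
        (fun k : nat => fine (objective f psi (x k)) - Fstar : R^o)
          =o_\oo (fun k : nat => k%:R^-1 : R^o) &
      forall k : nat,
        (newton_steps js k)%:R <=
          k%:R + 1 + log2 (Num.max 2^-1 (m * L / Lam0)) :> R].
Proof.
move=> D0.
have df : forall y, differentiable f y by case: hf.
have /andP[al0 al1] := halpha.
have /andP[be0 be1] := hbeta.
have hl : forall k, lam k <= Num.max (2 * (m * L)) Lam0.
  apply: (run_lam_le hrun Lam0_gt0) => [k j xp _ ml _ adm|k j jk ml].
    apply: (accepted_of_large_lambda hip df psi_proper (hHop (x k)) L_ge0 _
      al1 hm be1 _ ml _ adm).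
    - by move=> y; exact: hL.
    - by rewrite mulr_gt0 ?exprn_gt0// (run_Lam_gt0 hrun).
    - exact: (run_dom hrun).
  apply: computable; first exact: ltnW.
  by rewrite (le_trans _ ml)// ler_peMl.
have [z Sz] := S_nonempty.
have Fsz : objective f psi z = Fstar%:E by [].
have Fx := run_objective hrun psi_proper hx0.
have subx := run_sublevel hrun psi_proper hx0 Lam0_gt0 be0.
have subz : sublevel f psi x0 z.
  split; first by rewrite /dom_objective /= Fsz ltry.
  by rewrite Fsz.
have diam u v : sublevel f psi x0 u -> sublevel f psi x0 v -> `|u - v| <= D0.
  move=> su sv; apply: ub_le_sup; last by exists (u, v).
  have [M [_ hM]] := F0_bounded.
  have hM1 w : sublevel f psi x0 w -> `|w| <= `|M| + 1.
    by apply: hM; rewrite (le_lt_trans (ler_norm M))// ltrDl.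
  exists ((`|M| + 1) + (`|M| + 1)) => _ [[p q] /= [/hM1 hp /hM1 hq] <-].
  by rewrite (le_trans (ler_normB _ _))// lerD.
have D0_ge0 : 0 <= D0 by rewrite (le_trans _ (diam _ _ subz subz)).
pose a k := fine (objective f psi (x k)) - Fstar.
(* At [x0] the subgradient is the given one; afterwards it is the one that
   the subproblem produces. *)
pose F' k := if k is j.+1 then F_prime ip f Hop (lam j) (x j) (x k)
             else frechet f x0 + psi'0.
have hF' k : exists2 phi, subdifferential psi (x k) phi & F' k = frechet f (x k) + phi.
  case: k => [|k] /=.
    by exists psi'0; rewrite (run_x0 hrun).
  have [_ [sub _] _] := run_accepted hrun k.
  by exists (psi_prime ip f Hop (lam k) (x k) (x k.+1)).
have dF' k : in_dual (F' k).
  have [phi [dphi _ _] ->] := hF' k.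
  by apply: in_dualD => //; exact: in_dual_frechet.
pose g k := dual_norm (F' k).
have g0 k : 0 <= g k by exact: dual_norm_ge0.
have a0 k : 0 <= a k by rewrite subr_ge0 -lee_fin -Fx.
have ag k : a k <= g k * D0.
  have [phi sub eF] := hF' k.
  apply: le_trans (composite_subgradient (df _) F_convex (subx k) subz sub (Fx k) Fsz) _.
  rewrite -eF; apply: le_trans (ler_norm _) _.
  apply: le_trans (le_dual_norm _ (dF' k)) _.
  by apply: ler_wpM2l; [exact: g0|exact: diam].
have dec k : alpha / lam k * g k.+1 ^+ 2 <= a k - a k.+1.
  have [_ _ [grad _]] := run_accepted hrun k.
  apply: le_trans grad _.
  have [phi sub eF] := hF' k.+1.
  have := composite_subgradient (df _) F_convex (subx k.+1) (subx k) sub (Fx k.+1) (Fx k).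
  have <- : - (x k.+1 - x k) = x k - x k.+1 by rewrite opprB.
  rewrite -eF -[F_prime _ _ _ _ _ _]/(F' k.+1) (in_dualNE _ (dF' k.+1)) /a; lra.
split.
- move=> k k1; rewrite Fx -EFinB lee_fin.
  rewrite -[2 * m * L]mulrA; apply: (gap_decay_rate al0 D0_ge0 _ a0 g0 ag dec k1) => i.
  by rewrite (run_lam_gt0 hrun)// hl.
- move=> lam0; apply: (gap_decay_littleo al0 D0_ge0 _ lam0 a0 g0 ag dec) => i.
  exact: (run_lam_gt0 hrun).
- exact: (newton_steps_le hrun Lam0_gt0 hl).
Qed.
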